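(* Let $\{\mathbb{X}_n\}_{n\in\mathbb{N}}$ be a sequence of non-trivial normed linear spaces over $\mathbb{K}$ and let $p\in(1,\infty)$. A non-zero element $x=\{x_n\}_{n\in\mathbb{N}}\in\bigoplus_p\mathbb{X}_n$ is smooth if and only if $x_n\in\mathbb{X}_n$ is smooth for every $n$ with $x_n\neq0$.
   Context: $\mathbb{K}=\mathbb{R}$ or $\mathbb{C}$; non-trivial means of dimension more than $0$. For $1\le p<\infty$, $\bigoplus_p\mathbb{X}_n$ is the space of sequences $\{x_n\}$ with $x_n\in\mathbb{X}_n$ and $\sum_n\|x_n\|^p<\infty$, with norm $\|\{x_n\}\|_p=(\sum_n\|x_n\|^p)^{1/p}$. A non-zero element $x$ of a normed space $\mathbb{X}$ is smooth if there is exactly one $f\in\mathbb{X}^*$ with $\|f\|=1$ and $f(x)=\|x\|$. *)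

(* Defs.v *)
From Stdlib Require Import Reals Lra FunctionalExtensionality ProofIrrelevance.
From Coquelicot Require Import Coquelicot.
Open Scope R_scope.

(* Coquelicot's [NormedModule] only requires [norm (scal l x) <= abs l * norm x];
   over R and C this implies equality, so a [NormedModule (scalar_field k)] is
   a normed space whose uniform structure is the one given by the norm. *)
Inductive scalars : Set := RealScalars | ComplexScalars.

Definition scalar_field (k : scalars) : AbsRing :=
  match k with
  | RealScalars => R_AbsRing
  | ComplexScalars => C_AbsRing
  end.

Definition of_real (k : scalars) : R -> scalar_field k :=
  match k return R -> scalar_field k with
  | RealScalars => fun r => r
  | ComplexScalars => RtoC
  end.

Definition dual_norm {K : AbsRing} {X : NormedModule K}
    (f : X -> AbsRing_NormedModule K) : Rbar :=
  Lub_Rbar (fun r : R => exists v : X, norm v <= 1 /\ r = norm (f v)).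

(* Boundedness is a field of Coquelicot's [is_linear], so [is_linear f] says
   that [f] belongs to the dual space. *)
Definition support_functional {k : scalars}
    {X : NormedModule (scalar_field k)} (x : X)
    (f : X -> AbsRing_NormedModule (scalar_field k)) : Prop :=
  is_linear f /\ dual_norm f = Finite 1 /\ f x = of_real k (norm x).

Definition smooth {k : scalars} {X : NormedModule (scalar_field k)} (x : X)
    : Prop :=
  x <> zero /\
  exists! f : X -> AbsRing_NormedModule (scalar_field k),
    support_functional x f.

(* [Rpower 0 p] is [1] because [ln 0 = 0]; here [rpow 0 p = 0]. *)
Definition rpow (x p : R) : R := if Rlt_dec 0 x then Rpower x p else 0.

Lemma rpow_pos (x p : R) : 0 < x -> rpow x p = Rpower x p.
Proof. intros H; unfold rpow; destruct (Rlt_dec 0 x); [reflexivity | lra]. Qed.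

Lemma rpow_0 (p : R) : rpow 0 p = 0.
Proof. unfold rpow; destruct (Rlt_dec 0 0); [lra | reflexivity]. Qed.

Lemma rpow_gt0 (x p : R) : 0 < x -> 0 < rpow x p.
Proof. intros H; rewrite rpow_pos by exact H; apply exp_pos. Qed.

Lemma rpow_ge0 (x p : R) : 0 <= rpow x p.
Proof.
unfold rpow; destruct (Rlt_dec 0 x); [left; apply exp_pos | right; reflexivity].
Qed.

Lemma rpow_le (x y p : R) : 0 <= p -> 0 <= x <= y -> rpow x p <= rpow y p.
Proof.
intros Hp Hxy; destruct (Rlt_dec 0 x) as [H|H].
- rewrite !rpow_pos by lra; apply Rle_Rpower_l; lra.
- replace x with 0 by lra; rewrite rpow_0; apply rpow_ge0.
Qed.

Lemma rpow_mult (x y p : R) :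
  0 <= x -> 0 <= y -> rpow (x * y) p = rpow x p * rpow y p.
Proof.
intros Hx Hy.
destruct (Rlt_dec 0 x) as [Hx'|Hx'];
  [|replace x with 0 by lra; rewrite Rmult_0_l, rpow_0; ring].
destruct (Rlt_dec 0 y) as [Hy'|Hy'];
  [|replace y with 0 by lra; rewrite Rmult_0_r, rpow_0; ring].
rewrite !rpow_pos by (try apply Rmult_lt_0_compat; assumption).
symmetry; apply Rpower_mult_distr; assumption.
Qed.

Lemma rpow_inv_r (x p : R) : 0 <= x -> 0 < p -> rpow (rpow x p) (/ p) = x.
Proof.
intros Hx Hp; destruct (Rlt_dec 0 x) as [H|H].
- rewrite (rpow_pos (rpow x p)) by (apply rpow_gt0; exact H).
  rewrite rpow_pos by exact H.
  rewrite Rpower_mult, Rinv_r, Rpower_1; lra.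
- replace x with 0 by lra; rewrite !rpow_0; reflexivity.
Qed.

Lemma rpow_inv_l (x p : R) : 0 <= x -> 0 < p -> rpow (rpow x (/ p)) p = x.
Proof.
intros Hx Hp; destruct (Rlt_dec 0 x) as [H|H].
- rewrite (rpow_pos (rpow x (/ p))) by (apply rpow_gt0; exact H).
  rewrite rpow_pos by exact H.
  rewrite Rpower_mult, Rinv_l, Rpower_1; lra.
- replace x with 0 by lra; rewrite !rpow_0; reflexivity.
Qed.

Lemma rpow_bernoulli (t p : R) :
  1 <= p -> 0 <= t -> 1 + p * (t - 1) <= rpow t p.
Proof.
intros Hp Ht; destruct (Rlt_dec 0 t) as [H|H]; cycle 1.
  replace t with 0 by lra; rewrite rpow_0; lra.
rewrite rpow_pos by exact H; unfold Rpower.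
destruct (Rlt_dec 0 (1 + p * (t - 1))) as [Hm|Hm]; cycle 1.
  apply Rle_trans with 0; [lra | left; apply exp_pos].
set (s := exp (p * ln t)).
assert (Hs : 0 < s) by apply exp_pos.
assert (Hls : ln s = p * ln t) by apply ln_exp.
assert (Ht1 : 1 + ln (s / t) <= s / t).
{ rewrite <- (exp_ln (s / t)) at 2 by (apply Rdiv_lt_0_compat; assumption).
  apply exp_ineq1_le. }
assert (Ht2 : 1 + ln (/ t) <= / t).
{ rewrite <- (exp_ln (/ t)) at 2 by (apply Rinv_0_lt_compat; assumption).
  apply exp_ineq1_le. }
rewrite ln_div in Ht1 by assumption.
rewrite ln_Rinv in Ht2 by assumption.
rewrite Hls in Ht1.
assert (Hsum : p <= s / t + (p - 1) * / t) by nra.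
assert (Hsum' : p * t <= s + (p - 1)).
{ replace (s + (p - 1)) with ((s / t + (p - 1) * / t) * t) by (field; lra).
  apply Rmult_le_compat_r; lra. }
lra.
Qed.

Lemma rpow_convex (l u v p : R) :
  1 <= p -> 0 <= l <= 1 -> 0 <= u -> 0 <= v ->
  rpow (l * u + (1 - l) * v) p <= l * rpow u p + (1 - l) * rpow v p.
Proof.
intros Hp Hl Hu Hv; set (m := l * u + (1 - l) * v).
assert (Hm0 : 0 <= m) by (unfold m; nra).
assert (Hru := rpow_ge0 u p); assert (Hrv := rpow_ge0 v p).
destruct (Rlt_dec 0 m) as [Hm|Hm]; cycle 1.
  replace m with 0 by lra; rewrite rpow_0; nra.
assert (Htan : forall w, 0 <= w ->
  rpow m p * (1 + p * (w / m - 1)) <= rpow w p).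
{ intros w Hw.
  assert (Hwm : 0 <= w / m) by
    (apply Rmult_le_pos; [exact Hw | left; apply Rinv_0_lt_compat, Hm]).
  replace w with (m * (w / m)) at 2 by (field; lra).
  rewrite rpow_mult by assumption.
  apply Rmult_le_compat_l; [apply rpow_ge0 | apply rpow_bernoulli; assumption]. }
assert (Hsum : l * (1 + p * (u / m - 1)) + (1 - l) * (1 + p * (v / m - 1)) = 1)
  by (unfold m; field; fold m; lra).
assert (Hu' := Htan u Hu); assert (Hv' := Htan v Hv).
apply Rle_trans with (rpow m p * (l * (1 + p * (u / m - 1))
   + (1 - l) * (1 + p * (v / m - 1)))); [rewrite Hsum; lra|].
nra.
Qed.

Lemma rpow_add_le (A B a b p : R) :
  1 <= p -> 0 < A -> 0 < B -> 0 <= a -> 0 <= b ->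
  rpow (a + b) p <=
    rpow (A + B) p * (A / (A + B) / rpow A p) * rpow a p +
    rpow (A + B) p * (B / (A + B) / rpow B p) * rpow b p.
Proof.
intros Hp HA HB Ha Hb.
assert (HpA := rpow_gt0 A p HA); assert (HpB := rpow_gt0 B p HB).
assert (Hdiv : forall c C, 0 <= c -> 0 < C ->
  0 <= c / C /\ rpow (c / C) p = rpow c p / rpow C p).
{ intros c C Hc HC.
  assert (H0 : 0 <= c / C) by
    (apply Rmult_le_pos; [exact Hc | left; apply Rinv_0_lt_compat, HC]).
  split; [exact H0|].
  assert (HpC := rpow_gt0 C p HC).
  replace c with (C * (c / C)) at 2 by (field; lra).
  rewrite rpow_mult by lra; field; lra. }
destruct (Hdiv a A Ha HA) as [HaA HaA'].
destruct (Hdiv b B Hb HB) as [HbB HbB'].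
set (l := A / (A + B)).
assert (Hl : 0 <= l <= 1).
{ unfold l; split.
  - apply Rlt_le, Rdiv_lt_0_compat; lra.
  - apply Rmult_le_reg_r with (A + B); [lra|].
    replace (A / (A + B) * (A + B)) with A by (field; lra); lra. }
assert (Hl1 : B / (A + B) = 1 - l) by (unfold l; field; lra).
replace (a + b) with ((A + B) * (l * (a / A) + (1 - l) * (b / B)))
  by (unfold l; field; lra).
rewrite rpow_mult by nra.
assert (Hc := rpow_convex l (a / A) (b / B) p Hp Hl HaA HbB).
rewrite HaA', HbB' in Hc.
apply Rle_trans with (rpow (A + B) p *
  (l * (rpow a p / rpow A p) + (1 - l) * (rpow b p / rpow B p))).
- apply Rmult_le_compat_l; [apply rpow_ge0 | exact Hc].
- rewrite Hl1; right; field; lra.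
Qed.

Lemma ex_series_le_pos (a b : nat -> R) :
  (forall n, 0 <= a n <= b n) -> ex_series b -> ex_series a.
Proof.
intros H Hb; apply (ex_series_le a b); [|exact Hb].
intros n; change (Rabs (a n) <= b n); rewrite Rabs_pos_eq; apply H.
Qed.

Lemma Series_ge0 (a : nat -> R) :
  (forall n, 0 <= a n) -> ex_series a -> 0 <= Series a.
Proof.
intros Ha Hex.
replace 0 with (Series (fun n => 0 * a n)).
- apply Series_le; [intros n; specialize (Ha n); lra | exact Hex].
- rewrite Series_scal_l; ring.
Qed.

Lemma Series_ge_term (a : nat -> R) (n : nat) :
  (forall n, 0 <= a n) -> ex_series a -> a n <= Series a.
Proof.
intros Ha Hex.
rewrite (Series_incr_n a (S n)) by (try apply Nat.lt_0_succ; exact Hex).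
simpl pred.
assert (Htail : 0 <= Series (fun k => a (S n + k)%nat)).
{ apply Series_ge0; [intros; apply Ha |].
  apply (ex_series_incr_n a (S n)); exact Hex. }
assert (Hsum : a n <= sum_f_R0 a n).
{ destruct n as [|n]; simpl; [lra|].
  assert (0 <= sum_f_R0 a n) by (apply cond_pos_sum; exact Ha); lra. }
lra.
Qed.

Section Minkowski.
Variables (p : R) (a b c : nat -> R).
Hypothesis Hp : 1 <= p.
Hypothesis Ha : forall n, 0 <= a n.
Hypothesis Hb : forall n, 0 <= b n.
Hypothesis Hc : forall n, 0 <= c n <= a n + b n.
Hypothesis Hsa : ex_series (fun n => rpow (a n) p).
Hypothesis Hsb : ex_series (fun n => rpow (b n) p).

Let bound (A B : R) (n : nat) : R :=
  rpow (A + B) p * (A / (A + B) / rpow A p) * rpow (a n) p +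
  rpow (A + B) p * (B / (A + B) / rpow B p) * rpow (b n) p.

Lemma bound_ex (A B : R) : ex_series (bound A B).
Proof.
apply (ex_series_plus (V := R_NormedModule)
  (fun n => rpow (A + B) p * (A / (A + B) / rpow A p) * rpow (a n) p)
  (fun n => rpow (A + B) p * (B / (A + B) / rpow B p) * rpow (b n) p)).
- apply (ex_series_scal_l (V := R_NormedModule) _ (fun n => rpow (a n) p) Hsa).
- apply (ex_series_scal_l (V := R_NormedModule) _ (fun n => rpow (b n) p) Hsb).
Qed.

Lemma bound_le (A B : R) (n : nat) :
  0 < A -> 0 < B -> 0 <= rpow (c n) p <= bound A B n.
Proof.
intros HA HB; split; [apply rpow_ge0|].
apply Rle_trans with (rpow (a n + b n) p).
- apply rpow_le; [lra | apply Hc].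
- apply rpow_add_le; auto.
Qed.

Lemma minkowski_ex : ex_series (fun n => rpow (c n) p).
Proof.
apply ex_series_le_pos with (bound 1 1); [|apply bound_ex].
intros n; apply bound_le; lra.
Qed.

Lemma minkowski_le :
  rpow (Series (fun n => rpow (c n) p)) (/ p) <=
  rpow (Series (fun n => rpow (a n) p)) (/ p) +
  rpow (Series (fun n => rpow (b n) p)) (/ p).
Proof.
set (sa := Series (fun n => rpow (a n) p)).
set (sb := Series (fun n => rpow (b n) p)).
assert (Hsa0 : 0 <= sa) by
  (apply Series_ge0; [intros; apply rpow_ge0 | exact Hsa]).
assert (Hsb0 : 0 <= sb) by
  (apply Series_ge0; [intros; apply rpow_ge0 | exact Hsb]).
assert (Hsc0 : 0 <= Series (fun n => rpow (c n) p)) by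
  (apply Series_ge0; [intros; apply rpow_ge0 | exact minkowski_ex]).
assert (HA0 := rpow_ge0 sa (/ p)); assert (HB0 := rpow_ge0 sb (/ p)).
assert (Hip : 0 <= / p) by (left; apply Rinv_0_lt_compat; lra).
apply le_epsilon; intros eps Heps.
set (A := rpow sa (/ p) + eps / 2); set (B := rpow sb (/ p) + eps / 2).
assert (HA : 0 < A) by (unfold A; lra).
assert (HB : 0 < B) by (unfold B; lra).
assert (HpA := rpow_gt0 A p HA); assert (HpB := rpow_gt0 B p HB).
assert (HsA : sa <= rpow A p).
{ rewrite <- (rpow_inv_l sa p) by lra; apply rpow_le; unfold A; lra. }
assert (HsB : sb <= rpow B p).
{ rewrite <- (rpow_inv_l sb p) by lra; apply rpow_le; unfold B; lra. }
replace (rpow sa (/ p) + rpow sb (/ p) + eps) with (A + B)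
  by (unfold A, B; field).
rewrite <- (rpow_inv_r (A + B) p) by lra.
apply rpow_le; [exact Hip | split; [exact Hsc0|]].
apply Rle_trans with (Series (bound A B)).
  apply Series_le; [intros n; apply bound_le; assumption | apply bound_ex].
unfold bound; rewrite Series_plus.
2: apply (ex_series_scal_l (V := R_NormedModule) _ (fun n => rpow (a n) p) Hsa).
2: apply (ex_series_scal_l (V := R_NormedModule) _ (fun n => rpow (b n) p) Hsb).
rewrite !Series_scal_l; fold sa sb.
assert (HAB := rpow_gt0 (A + B) p ltac:(lra)).
assert (H1 : rpow (A + B) p * (A / (A + B) / rpow A p) * sa <=
             rpow (A + B) p * (A / (A + B))).
{ replace (rpow (A + B) p * (A / (A + B)))
    with (rpow (A + B) p * (A / (A + B) / rpow A p) * rpow A p)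
    by (field; lra).
  apply Rmult_le_compat_l; [|exact HsA].
  left; apply Rmult_lt_0_compat; [exact HAB|].
  repeat apply Rdiv_lt_0_compat; lra. }
assert (H2 : rpow (A + B) p * (B / (A + B) / rpow B p) * sb <=
             rpow (A + B) p * (B / (A + B))).
{ replace (rpow (A + B) p * (B / (A + B)))
    with (rpow (A + B) p * (B / (A + B) / rpow B p) * rpow B p)
    by (field; lra).
  apply Rmult_le_compat_l; [|exact HsB].
  left; apply Rmult_lt_0_compat; [exact HAB|].
  repeat apply Rdiv_lt_0_compat; lra. }
assert (H3 : rpow (A + B) p * (A / (A + B)) + rpow (A + B) p * (B / (A + B))
             = rpow (A + B) p) by (field; lra).
lra.
Qed.

End Minkowski.

Record lp_seq {K : AbsRing} (X : nat -> NormedModule K) (p : R) : Type :=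
  mk_lp_seq {
    lp_coord : forall n, X n;
    lp_summable : ex_series (fun n => rpow (norm (lp_coord n)) p)
  }.
Arguments mk_lp_seq {K X p}.
Arguments lp_coord {K X p}.
Arguments lp_summable {K X p}.

Section LpSum.
Variables (K : AbsRing) (X : nat -> NormedModule K) (p : R).
Hypothesis Hp : 1 <= p.

Lemma lp_seq_ext (x y : lp_seq X p) :
  (forall n, lp_coord x n = lp_coord y n) -> x = y.
Proof.
destruct x as [x Hx], y as [y Hy]; simpl; intros H.
assert (E : x = y) by (apply functional_extensionality_dep; exact H).
subst y; f_equal; apply proof_irrelevance.
Qed.

Lemma lp_plus_summable (x y : lp_seq X p) :
  ex_series (fun n => rpow (norm (plus (lp_coord x n) (lp_coord y n))) p).
Proof.
apply minkowski_ex with (a := fun n => norm (lp_coord x n))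
                        (b := fun n => norm (lp_coord y n)).
- exact Hp.
- intros; apply norm_ge_0.
- intros; apply norm_ge_0.
- intros; split; [apply norm_ge_0 | apply norm_triangle].
- exact (lp_summable x).
- exact (lp_summable y).
Qed.

Lemma lp_zero_summable :
  ex_series (fun n => rpow (norm (zero : X n)) p).
Proof.
apply ex_series_le_pos with (fun n => (/ 2) ^ n).
- intros n; rewrite norm_zero, rpow_0.
  split; [lra | apply pow_le; lra].
- apply ex_series_geom; rewrite Rabs_pos_eq; lra.
Qed.

Lemma lp_opp_summable (x : lp_seq X p) :
  ex_series (fun n => rpow (norm (opp (lp_coord x n))) p).
Proof.
apply (ex_series_ext (fun n => rpow (norm (lp_coord x n)) p)).
- intros n; rewrite norm_opp; reflexivity.
- exact (lp_summable x).
Qed.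

Lemma lp_scal_le (l : K) (x : lp_seq X p) (n : nat) :
  0 <= rpow (norm (scal l (lp_coord x n))) p <=
  rpow (abs l) p * rpow (norm (lp_coord x n)) p.
Proof.
split; [apply rpow_ge0|].
rewrite <- rpow_mult by (apply abs_ge_0 || apply norm_ge_0).
apply rpow_le; [lra | split; [apply norm_ge_0 | apply norm_scal]].
Qed.

Lemma lp_scal_summable (l : K) (x : lp_seq X p) :
  ex_series (fun n => rpow (norm (scal l (lp_coord x n))) p).
Proof.
apply ex_series_le_pos with
  (fun n => rpow (abs l) p * rpow (norm (lp_coord x n)) p).
- apply lp_scal_le.
- apply (ex_series_scal_l (V := R_NormedModule) _ _ (lp_summable x)).
Qed.

Definition lp_plus (x y : lp_seq X p) : lp_seq X p :=
  mk_lp_seq (fun n => plus (lp_coord x n) (lp_coord y n)) (lp_plus_summable x y).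
Definition lp_zero : lp_seq X p := mk_lp_seq (fun n => zero) lp_zero_summable.
Definition lp_opp (x : lp_seq X p) : lp_seq X p :=
  mk_lp_seq (fun n => opp (lp_coord x n)) (lp_opp_summable x).
Definition lp_scal (l : K) (x : lp_seq X p) : lp_seq X p :=
  mk_lp_seq (fun n => scal l (lp_coord x n)) (lp_scal_summable l x).

Definition lp_norm (x : lp_seq X p) : R :=
  rpow (Series (fun n => rpow (norm (lp_coord x n)) p)) (/ p).

Lemma lp_norm_ge0 (x : lp_seq X p) : 0 <= lp_norm x.
Proof. apply rpow_ge0. Qed.

Lemma lp_norm_ext (x y : lp_seq X p) :
  (forall n, norm (lp_coord x n) = norm (lp_coord y n)) ->
  lp_norm x = lp_norm y.
Proof.
intros H; unfold lp_norm; f_equal; apply Series_ext; intros n.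
rewrite H; reflexivity.
Qed.

Lemma lp_norm_triangle (x y : lp_seq X p) :
  lp_norm (lp_plus x y) <= lp_norm x + lp_norm y.
Proof.
apply (minkowski_le p (fun n => norm (lp_coord x n))
  (fun n => norm (lp_coord y n))).
- exact Hp.
- intros; apply norm_ge_0.
- intros; apply norm_ge_0.
- intros; split; [apply norm_ge_0 | apply norm_triangle].
- exact (lp_summable x).
- exact (lp_summable y).
Qed.

Lemma lp_norm_scal (l : K) (x : lp_seq X p) :
  lp_norm (lp_scal l x) <= abs l * lp_norm x.
Proof.
assert (Hip : 0 <= / p) by (left; apply Rinv_0_lt_compat; lra).
unfold lp_norm; rewrite <- (rpow_inv_r (abs l) p) by (apply abs_ge_0 || lra).
rewrite <- rpow_mult; [|apply rpow_ge0|].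
2: apply Series_ge0; [intros; apply rpow_ge0 | exact (lp_summable x)].
rewrite <- Series_scal_l.
apply rpow_le; [exact Hip | split].
- apply Series_ge0; [intros; apply rpow_ge0 | exact (lp_scal_summable l x)].
- apply Series_le; [apply lp_scal_le|].
  apply (ex_series_scal_l (V := R_NormedModule) _ _ (lp_summable x)).
Qed.

Lemma lp_norm_eq0 (x : lp_seq X p) : lp_norm x = 0 -> x = lp_zero.
Proof.
intros H; apply lp_seq_ext; intros n; simpl.
apply norm_eq_zero.
destruct (Rle_lt_or_eq_dec _ _ (norm_ge_0 (lp_coord x n))) as [Hn|Hn];
  [exfalso | auto].
assert (Hs := Series_ge_term (fun n => rpow (norm (lp_coord x n)) p) n
  (fun n => rpow_ge0 _ _) (lp_summable x)).
assert (Hn' := rpow_gt0 _ p Hn); simpl in Hs.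
assert (Hs' := rpow_gt0 (Series (fun n => rpow (norm (lp_coord x n)) p)) (/ p)
  ltac:(lra)).
unfold lp_norm in H; lra.
Qed.

Definition lp_AbelianMonoid_mixin : AbelianMonoid.mixin_of (lp_seq X p).
Proof.
refine (AbelianMonoid.Mixin (lp_seq X p) lp_plus lp_zero _ _ _);
  intros; apply lp_seq_ext; intros n; simpl.
- apply plus_comm.
- apply plus_assoc.
- apply plus_zero_r.
Defined.

Definition lp_AbelianMonoid : AbelianMonoid :=
  AbelianMonoid.Pack (lp_seq X p) lp_AbelianMonoid_mixin (lp_seq X p).

Definition lp_AbelianGroup_mixin : AbelianGroup.mixin_of lp_AbelianMonoid.
Proof.
refine (AbelianGroup.Mixin lp_AbelianMonoid lp_opp _).
intros x; apply lp_seq_ext; intros n; exact (plus_opp_r (lp_coord x n)).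
Defined.

Definition lp_AbelianGroup_class : AbelianGroup.class_of (lp_seq X p) :=
  AbelianGroup.Class _ lp_AbelianMonoid_mixin lp_AbelianGroup_mixin.
Definition lp_AbelianGroup : AbelianGroup :=
  AbelianGroup.Pack (lp_seq X p) lp_AbelianGroup_class (lp_seq X p).

Definition lp_ModuleSpace_mixin : ModuleSpace.mixin_of K lp_AbelianGroup.
Proof.
refine (ModuleSpace.Mixin K lp_AbelianGroup lp_scal _ _ _ _);
  intros; apply lp_seq_ext; intros n; simpl.
- apply scal_assoc.
- apply (scal_one (V := X n)).
- apply (scal_distr_l (V := X n)).
- apply (scal_distr_r (V := X n)).
Defined.

Definition lp_ModuleSpace_class : ModuleSpace.class_of K (lp_seq X p) :=
  ModuleSpace.Class K _ lp_AbelianGroup_class lp_ModuleSpace_mixin.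

Definition lp_ball (x : lp_seq X p) (e : R) (y : lp_seq X p) : Prop :=
  lp_norm (lp_plus y (lp_opp x)) < e.

Definition lp_UniformSpace_mixin : UniformSpace.mixin_of (lp_seq X p).
Proof.
refine (UniformSpace.Mixin (lp_seq X p) lp_zero lp_ball _ _ _).
- intros x e; unfold lp_ball.
  replace (lp_plus x (lp_opp x)) with (lp_scal zero lp_zero).
  + apply Rle_lt_trans with (1 := lp_norm_scal _ _).
    rewrite abs_zero, Rmult_0_l; apply cond_pos.
  + apply lp_seq_ext; intros n; simpl.
    transitivity (zero : X n); [apply (scal_zero_l (V := X n)) |].
    symmetry; apply (plus_opp_r (G := X n)).
- intros x y e; unfold lp_ball; intros H.
  rewrite (lp_norm_ext _ (lp_plus y (lp_opp x))); [exact H|].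
  intros n; simpl.
  rewrite <- norm_opp; f_equal; apply (opp_minus (G := X n)).
- intros x y z e1 e2; unfold lp_ball; intros H1 H2.
  replace (lp_plus z (lp_opp x))
    with (lp_plus (lp_plus y (lp_opp x)) (lp_plus z (lp_opp y))).
  + apply Rle_lt_trans with (1 := lp_norm_triangle _ _); lra.
  + apply lp_seq_ext; intros n; simpl.
    etransitivity; [apply (plus_comm (G := X n)) | symmetry].
    apply (minus_trans (G := X n)).
Defined.

Definition lp_NormedModuleAux_class : NormedModuleAux.class_of K (lp_seq X p) :=
  NormedModuleAux.Class K _ lp_ModuleSpace_class lp_UniformSpace_mixin.
Definition lp_NormedModuleAux : NormedModuleAux K :=
  NormedModuleAux.Pack K (lp_seq X p) lp_NormedModuleAux_class (lp_seq X p).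

Definition lp_NormedModule_mixin : NormedModule.mixin_of K lp_NormedModuleAux.
Proof.
refine (NormedModule.Mixin K lp_NormedModuleAux lp_norm 1 _ _ _ _ _).
- exact lp_norm_triangle.
- exact lp_norm_scal.
- intros x y e H; exact H.
- intros x y e H; rewrite Rmult_1_l; exact H.
- exact lp_norm_eq0.
Defined.

Definition lp_sum : NormedModule K :=
  NormedModule.Pack K (lp_seq X p)
    (NormedModule.Class K _ lp_NormedModuleAux_class lp_NormedModule_mixin)
    (lp_seq X p).

End LpSum.

Arguments lp_sum {K} X {p} Hp.

(* Main.v *)
(* Write [a_n = |x_n|^(p-1) / |x|^(p-1)].  If [f] is a norming functional of
   [x], differentiating the norm in the [n]-th coordinate forces
   [u |-> f (u in coordinate n)] to be [a_n] times a norming functional of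
   [x_n].  Conversely, by Hoelder's inequality any choice of norming
   functionals [g_n] of the [x_n] yields the norming functional
   [v |-> sum_n a_n g_n(v_n)] of [x].  As a continuous functional on the sum is
   determined by its restrictions to the summands, and [a_n = 0] exactly when
   [x_n = 0], the norming functional of [x] is unique iff those of the non-zero
   [x_n] are.  Every existence statement is transported from one side to the
   other, so the Hahn-Banach theorem is not needed. *)

Require Import Defs.
From Stdlib Require Import Reals Lra Lia PeanoNat Compare_dec Eqdep_dec.
From Stdlib Require Import Classical ClassicalEpsilon FunctionalExtensionality.
From Coquelicot Require Import Coquelicot.
Open Scope R_scope.

(** * Real powers: tangents, continuity and limits; one-term series *)

Lemma rpow_pred (r p : R) : 0 <= r -> rpow r p = rpow r (p - 1) * r.
Proof.
intros Hr; destruct (Rle_lt_or_eq_dec _ _ Hr) as [H|<-].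
- rewrite !rpow_pos by exact H.
  rewrite <- (Rpower_1 r) at 3 by exact H.
  rewrite <- Rpower_plus; f_equal; ring.
- rewrite !rpow_0; ring.
Qed.

(** Convexity of the [p]-th power: for [r > 0] and [y >= 0] this is Bernoulli's inequality at
    [y / r], scaled by [rpow r p]. Extended by 0 to negative [y] the power stays convex, and at
    [r = 0] the tangent is horizontal, [p - 1] being positive. *)
Lemma rpow_tangent (p r y : R) :
  1 < p -> 0 <= r -> rpow r p + p * rpow r (p - 1) * (y - r) <= rpow y p.
Proof.
intros Hp Hr; destruct (Rle_lt_or_eq_dec _ _ Hr) as [H|<-]; cycle 1.
{ rewrite !rpow_0; assert (Hy := rpow_ge0 y p); lra. }
assert (H1 := rpow_gt0 r (p - 1) H).
destruct (Rlt_dec y 0) as [Hy|Hy].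
(* For [y < 0] the left side factors as [- rpow r (p - 1) * ((p - 1) * r - p * y)], which is at most
   0. *)
- apply Rle_trans with 0; [|apply rpow_ge0].
  rewrite (rpow_pred r p Hr).
  assert (0 <= rpow r (p - 1) * ((p - 1) * r - p * y)); [|lra].
  apply Rmult_le_pos; nra.
- assert (Ht : 0 <= y / r)
    by (apply Rmult_le_pos; [lra | left; apply Rinv_0_lt_compat, H]).
  assert (Hb := rpow_bernoulli (y / r) p (Rlt_le _ _ Hp) Ht).
  replace y with (r * (y / r)) at 2 by (field; lra).
  rewrite rpow_mult by assumption.
  apply Rle_trans with (rpow r p * (1 + p * (y / r - 1))).
  + rewrite (rpow_pred r p Hr); right; field; lra.
  + apply Rmult_le_compat_l; [apply rpow_ge0 | exact Hb].
Qed.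

Lemma rpow_continuous (q r : R) :
  0 < q -> 0 <= r -> continuity_pt (fun y => rpow y q) r.
Proof.
intros Hq Hr; destruct (Rle_lt_or_eq_dec _ _ Hr) as [H|<-].
- apply continuity_pt_ext_loc with (fun y => exp (q * ln y)).
  + exists (mkposreal r H); intros y Hy.
    assert (Hy0 : 0 < y).
    { change (Rabs (y - r) < r) in Hy; apply Rabs_def2 in Hy; lra. }
    rewrite rpow_pos by exact Hy0; reflexivity.
  + apply continuity_pt_filterlim.
    apply (ex_derive_continuous (fun y => exp (q * ln y)) r).
    auto_derive; exact H.
(* At 0 the modulus is the [q]-th root of [eps]; negative arguments are harmless since [rpow]
   vanishes there. *)
- intros eps Heps; exists (rpow eps (/ q)); split; [apply rpow_gt0, Heps|].
  intros y [_ Hy]; unfold dist in *; simpl in *; unfold R_dist in *.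
  rewrite rpow_0, Rminus_0_r, Rabs_pos_eq by apply rpow_ge0.
  rewrite Rminus_0_r in Hy; apply Rabs_def2 in Hy.
  destruct (Rlt_dec 0 y) as [Hy0|Hy0].
  + rewrite <- (rpow_inv_l eps q) by lra.
    assert (Hd := rpow_gt0 eps (/ q) Heps).
    rewrite (rpow_pos y), (rpow_pos (rpow eps (/ q))) by assumption.
    apply Rlt_Rpower_l; lra.
  + unfold rpow; destruct (Rlt_dec 0 y); [contradiction | exact Heps].
Qed.

Lemma rpow_lim (q r s : R) :
  0 < q -> 0 <= r ->
  is_lim_seq (fun n => rpow (r + / (INR n + 1) * s) q) (rpow r q).
Proof.
intros Hq Hr.
assert (Hlim : is_lim_seq (fun n => / (INR n + 1)) 0).
{ apply (is_lim_seq_inv _ p_infty); [|discriminate].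
  apply is_lim_seq_ext with (fun n => INR (S n)); [intros; apply S_INR|].
  apply (is_lim_seq_incr_1 INR p_infty), is_lim_seq_INR. }
apply (is_lim_seq_continuous (fun y => rpow y q)).
- apply rpow_continuous; assumption.
- replace (Finite r) with (Finite (r + 0 * s)) by (f_equal; ring).
  apply is_lim_seq_plus'; [apply is_lim_seq_const|].
  apply is_lim_seq_mult'; [exact Hlim | apply is_lim_seq_const].
Qed.

Lemma inv_succ_bounds (n : nat) : 0 < / (INR n + 1) <= 1.
Proof.
assert (H := pos_INR n); split.
- apply Rinv_0_lt_compat; lra.
- rewrite <- Rinv_1; apply Rinv_le_contravar; lra.
Qed.

(** This and its mirror image below carry out the passage t -> 0+ in difference quotients, sampled
    at t = 1/(n+1). *)
Lemma le_rpow_lim (q r s c : R) :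
  0 < q -> 0 <= r ->
  (forall t, 0 < t <= 1 -> c <= rpow (r + t * s) q) -> c <= rpow r q.
Proof.
intros Hq Hr Hc.
apply (is_lim_seq_le _ _ _ _ (fun n => Hc _ (inv_succ_bounds n))
  (is_lim_seq_const c) (rpow_lim q r s Hq Hr)).
Qed.

Lemma rpow_lim_le (q r s c : R) :
  0 < q -> 0 <= r ->
  (forall t, 0 < t <= 1 -> rpow (r + t * s) q <= c) -> rpow r q <= c.
Proof.
intros Hq Hr Hc.
apply (is_lim_seq_le _ _ _ _ (fun n => Hc _ (inv_succ_bounds n))
  (rpow_lim q r s Hq Hr) (is_lim_seq_const c)).
Qed.

Lemma is_series_single (n : nat) (a : nat -> R) :
  (forall m, m <> n -> a m = 0) -> is_series a (a n).
Proof.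
intros Ha.
assert (Hz : forall N, (N <= n)%nat -> sum_n a N = if Nat.eq_dec N n then a n else 0).
{ induction N as [|N IH]; intros HN.
  - rewrite sum_O; destruct (Nat.eq_dec 0 n) as [<-|H]; auto.
  - rewrite sum_Sn, IH by lia; destruct (Nat.eq_dec N n) as [H|H]; [lia|].
    destruct (Nat.eq_dec (S N) n) as [<-|H']; [|rewrite (Ha (S N)) by exact H'];
    unfold plus; simpl; ring. }
change (is_lim_seq (sum_n a) (a n)).
apply is_lim_seq_ext_loc with (fun _ => a n); [|apply is_lim_seq_const].
exists n; intros N HN; induction HN as [|N HN IH].
- rewrite Hz by lia; destruct (Nat.eq_dec n n); [reflexivity | lia].
- rewrite sum_Sn, <- IH, (Ha (S N)) by lia; unfold plus; simpl; ring.
Qed.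

(** * Real and complex scalars treated together, and their absolutely convergent sums *)

Definition scalar_re {k} : scalar_field k -> R :=
  match k return scalar_field k -> R with
  | RealScalars => fun r => r
  | ComplexScalars => Re
  end.

Lemma scalar_re_plus {k} (z w : scalar_field k) :
  scalar_re (plus z w) = scalar_re z + scalar_re w.
Proof. destruct k; reflexivity. Qed.

Lemma scalar_re_zero {k} : scalar_re (zero : scalar_field k) = 0.
Proof. destruct k; reflexivity. Qed.

Lemma scalar_re_le_abs {k} (z : scalar_field k) : Rabs (scalar_re z) <= abs z.
Proof. destruct k; [right; reflexivity | apply re_le_Cmod]. Qed.

Lemma scalar_re_of_real_mult {k} (r : R) (z : scalar_field k) :
  scalar_re (mult (of_real k r) z) = r * scalar_re z.
Proof.
destruct k; [reflexivity|].
unfold scalar_re, mult, Re; simpl; ring.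
Qed.

Lemma scalar_re_of_real {k} (r : R) : scalar_re (of_real k r) = r.
Proof. destruct k; reflexivity. Qed.

Lemma scalar_mult_comm {k} (z w : scalar_field k) : mult z w = mult w z.
Proof. destruct k; [apply Rmult_comm | apply Cmult_comm]. Qed.

Lemma scalar_mult_distr {k} (u z w : scalar_field k) :
  mult u (plus z w) =
  plus (mult u z : scalar_field k) (mult u w : scalar_field k).
Proof. apply (mult_distr_l (K := scalar_field k)). Qed.

Lemma scalar_mult_0 {k} (z : scalar_field k) : mult z (zero : scalar_field k) = (zero : scalar_field k).
Proof. apply (mult_zero_r (K := scalar_field k)). Qed.

Lemma of_real_mult {k} (r s : R) :
  mult (of_real k r) (of_real k s) = of_real k (r * s).
Proof. destruct k; [reflexivity | symmetry; apply RtoC_mult]. Qed.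

Lemma of_real_0 {k} : of_real k 0 = zero.
Proof. destruct k; reflexivity. Qed.

Lemma of_real_1 {k} : of_real k 1 = one.
Proof. destruct k; reflexivity. Qed.

Lemma of_real_plus {k} (r s : R) :
  of_real k (r + s) = plus (of_real k r) (of_real k s).
Proof. destruct k; [reflexivity | apply RtoC_plus]. Qed.

Lemma abs_of_real {k} (r : R) : abs (of_real k r) = Rabs r.
Proof. destruct k; [reflexivity | apply Cmod_R]. Qed.

(** For [z] non-zero take the conjugate of [z] divided by its modulus. The bound on [u] is an
    inequality so that [u = 0] can serve [z = 0]. *)
Lemma scalar_rotation {k} (z : scalar_field k) :
  exists u : scalar_field k, abs u <= 1 /\ mult u z = of_real k (abs z).
Proof.
destruct (Req_dec (abs z) 0) as [H|H].
- exists zero; split; [rewrite abs_zero; lra|].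
  rewrite H, of_real_0; apply (mult_zero_l (K := scalar_field k)).
- destruct k; simpl in *; unfold abs, mult in *; simpl in *.
  + exists (Rabs z / z); split.
    * assert (z <> 0) by (intros ->; rewrite Rabs_R0 in H; lra).
      unfold Rdiv; rewrite Rabs_mult, Rabs_inv, Rabs_Rabsolu; right; field; exact H.
    * field; intros ->; rewrite Rabs_R0 in H; lra.
  + assert (Hc : RtoC (Cmod z) <> 0) by (intros E; apply RtoC_inj in E; lra).
    exists (Cdiv (Cconj z) (Cmod z)); split.
    * rewrite Cmod_div, Cmod_R by exact Hc.
      rewrite Cmod_conj, Rabs_pos_eq by apply Cmod_ge_0; right; field; exact H.
    * assert (E := Cmod2_conj z).
      replace (Cconj z / Cmod z * z)%C with ((z * Cconj z) / Cmod z)%C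
        by (field; exact Hc).
      rewrite <- E, RtoC_pow; field; exact Hc.
Qed.

Lemma abs_le_of_re {k} (z : scalar_field k) (M : R) :
  (forall u : scalar_field k, abs u <= 1 -> scalar_re (mult u z) <= M) ->
  abs z <= M.
Proof.
intros H; destruct (scalar_rotation z) as [u [Hu E]].
specialize (H u Hu); rewrite E, scalar_re_of_real in H; exact H.
Qed.

(** The hypotheses squeeze the real part and the modulus to the same value [r], which leaves no room
    for an imaginary part. *)
Lemma of_real_of_re {k} (z : scalar_field k) (r : R) :
  abs z <= r -> r <= scalar_re z -> z = of_real k r.
Proof.
intros H1 H2; assert (H3 := scalar_re_le_abs z).
assert (H4 := Rle_abs (scalar_re z)).
destruct k; simpl in *.
- lra.
- destruct z as [a b]; unfold abs in *; simpl in *.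
  assert (E : Cmod (a, b) = a) by lra.
  assert (H : Cmod (a, b) ^ 2 = a ^ 2 + b ^ 2) by apply Cmod2_alt.
  rewrite E in H; assert (Hb : b = 0) by nra.
  unfold RtoC; f_equal; lra.
Qed.

(** In the complex case [u = 1] compares the real parts and [u = Ci] the imaginary parts, up to
    sign. *)
Lemma scalar_weak_ext {k} (z w : scalar_field k) :
  (forall u : scalar_field k, scalar_re (mult u z) = scalar_re (mult u w)) ->
  z = w.
Proof.
destruct k; simpl; unfold mult; simpl; intros H.
- specialize (H 1); lra.
- destruct z as [a b], w as [c d].
  assert (H1 := H 1%C); assert (H2 := H Ci).
  unfold Re in *; simpl in *; f_equal; lra.
Qed.

(* Testing a sum against all [u] through the real part reduces series of real
   or complex scalars to real series. *)
Lemma scalar_sum_exists {k} (a : nat -> scalar_field k) :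
  ex_series (fun n => abs (a n)) ->
  exists s : scalar_field k, forall u : scalar_field k,
    scalar_re (mult u s) = Series (fun n => scalar_re (mult u (a n))).
Proof.
intros Ha; destruct k; simpl in *.
- exists (Series a); intros u; symmetry; apply Series_scal_l.
- assert (H1 : ex_series (fun n => fst (a n))).
  { apply (ex_series_le (V := R_CompleteNormedModule) _ _) with (2 := Ha).
    intros n; apply re_le_Cmod. }
  assert (H2 : ex_series (fun n => snd (a n))).
  { apply (ex_series_le (V := R_CompleteNormedModule) _ _) with (2 := Ha).
    intros n; apply Rle_trans with (2 := Rmax_Cmod (a n)); apply Rmax_r. }
  exists (Series (fun n => fst (a n)), Series (fun n => snd (a n))).
  intros u; unfold mult, Re; simpl.
  rewrite Series_minus, !Series_scal_l; [reflexivity| |];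
  apply (ex_series_scal_l (V := R_NormedModule)); assumption.
Qed.

(** The defining property has at most one solution by [scalar_weak_ext]; where it has none, the
    value is arbitrary. This describes real and complex sums in the same way. *)
Definition scalar_sum {k} (a : nat -> scalar_field k) : scalar_field k :=
  epsilon (inhabits zero) (fun s => forall u : scalar_field k,
    scalar_re (mult u s) = Series (fun n => scalar_re (mult u (a n)))).

Lemma scalar_sum_spec {k} (a : nat -> scalar_field k) (u : scalar_field k) :
  ex_series (fun n => abs (a n)) ->
  scalar_re (mult u (scalar_sum a)) = Series (fun n => scalar_re (mult u (a n))).
Proof.
intros Ha.
exact (epsilon_spec (inhabits zero) _ (scalar_sum_exists a Ha) u).
Qed.

Lemma ex_series_scalar_re {k} (a : nat -> scalar_field k) (u : scalar_field k) :
  ex_series (fun n => abs (a n)) ->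
  ex_series (fun n => scalar_re (mult u (a n))).
Proof.
intros Ha; apply (ex_series_le (V := R_CompleteNormedModule) _
  (fun n => abs u * abs (a n))).
- intros n; apply Rle_trans with (1 := scalar_re_le_abs _), abs_mult.
- apply (ex_series_scal_l (V := R_NormedModule)); exact Ha.
Qed.

Lemma scalar_sum_plus {k} (a b : nat -> scalar_field k) :
  ex_series (fun n => abs (a n)) -> ex_series (fun n => abs (b n)) ->
  scalar_sum (fun n => plus (a n) (b n)) = plus (scalar_sum a) (scalar_sum b).
Proof.
intros Ha Hb; apply scalar_weak_ext; intros u.
assert (Hab : ex_series (fun n => abs (plus (a n) (b n)))).
{ apply ex_series_le_pos with (fun n => abs (a n) + abs (b n)).
  - intros n; split; [apply abs_ge_0 | apply abs_triangle].
  - apply (ex_series_plus (V := R_NormedModule)); assumption. }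
rewrite scalar_mult_distr, scalar_re_plus, !scalar_sum_spec by assumption.
rewrite <- Series_plus by (apply ex_series_scalar_re; assumption).
apply Series_ext; intros n; rewrite scalar_mult_distr; apply scalar_re_plus.
Qed.

Lemma scalar_sum_mult {k} (l : scalar_field k) (a : nat -> scalar_field k) :
  ex_series (fun n => abs (a n)) ->
  scalar_sum (fun n => mult l (a n)) = mult l (scalar_sum a).
Proof.
intros Ha; apply scalar_weak_ext; intros u.
assert (Hla : ex_series (fun n => abs (mult l (a n)))).
{ apply ex_series_le_pos with (fun n => abs l * abs (a n)).
  - intros n; split; [apply abs_ge_0 | apply abs_mult].
  - apply (ex_series_scal_l (V := R_NormedModule)); assumption. }
rewrite mult_assoc, !scalar_sum_spec by assumption.
apply Series_ext; intros n; rewrite mult_assoc; reflexivity.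
Qed.

(** Rotating the sum onto the non-negative reals reduces the claim to the triangle inequality for
    real series. *)
Lemma abs_scalar_sum_le {k} (a : nat -> scalar_field k) :
  ex_series (fun n => abs (a n)) ->
  abs (scalar_sum a) <= Series (fun n => abs (a n)).
Proof.
intros Ha; apply abs_le_of_re; intros u Hu.
rewrite scalar_sum_spec by exact Ha.
assert (Hle : forall n, Rabs (scalar_re (mult u (a n))) <= abs (a n)).
{ intros n; apply Rle_trans with (1 := scalar_re_le_abs _).
  apply Rle_trans with (1 := abs_mult _ _).
  assert (H := abs_ge_0 (a n)); nra. }
apply Rle_trans with (1 := Rle_abs _).
assert (Hex : ex_series (fun n => Rabs (scalar_re (mult u (a n))))).
{ apply ex_series_le_pos with (2 := Ha); intros n; split;
    [apply Rabs_pos | apply Hle]. }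
apply Rle_trans with (1 := Series_Rabs _ Hex).
apply Series_le; [intros n; split; [apply Rabs_pos | apply Hle] | exact Ha].
Qed.

Lemma scalar_sum_single {k} (n : nat) (a : nat -> scalar_field k) :
  (forall m, m <> n -> a m = zero) -> scalar_sum a = a n.
Proof.
intros Ha.
assert (Hex : ex_series (fun m => abs (a m))).
{ eexists; apply (is_series_single n); intros m Hm.
  rewrite (Ha m Hm); apply abs_zero. }
apply scalar_weak_ext; intros u; rewrite scalar_sum_spec by exact Hex.
apply is_series_unique.
apply (is_series_single n (fun m => scalar_re (mult u (a m)))); intros m Hm.
rewrite (Ha m Hm), scalar_mult_0; apply scalar_re_zero.
Qed.

Lemma scalar_sum_of_real {k} (b : nat -> R) :
  ex_series (fun n => Rabs (b n)) ->
  scalar_sum (fun n => of_real k (b n)) = of_real k (Series b).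
Proof.
intros Hb; apply scalar_weak_ext; intros u; rewrite scalar_sum_spec.
- rewrite scalar_mult_comm, scalar_re_of_real_mult, <- Series_scal_r.
  apply Series_ext; intros n.
  rewrite scalar_mult_comm; apply scalar_re_of_real_mult.
- apply ex_series_ext with (2 := Hb); intros n; symmetry; apply abs_of_real.
Qed.

(** * Norming functionals and smoothness *)

(** The norm axiom gives one inequality; applied to [/ t] and the vector [t v] it gives the
    other. *)
Lemma norm_scal_of_real {k} {X : NormedModule (scalar_field k)} (t : R) (v : X) :
  norm (scal (of_real k t) v) = Rabs t * norm v.
Proof.
assert (Hle : forall s (w : X), norm (scal (of_real k s) w) <= Rabs s * norm w).
{ intros s w; rewrite <- (abs_of_real (k := k)); apply norm_scal. }
apply Rle_antisym; [apply Hle|].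
destruct (Req_dec t 0) as [->|Ht].
- rewrite Rabs_R0, Rmult_0_l; apply norm_ge_0.
- assert (E : v = scal (of_real k (/ t)) (scal (of_real k t) v)).
  { rewrite scal_assoc, of_real_mult, Rinv_l, of_real_1 by exact Ht.
    symmetry; apply (scal_one (V := X)). }
  rewrite E at 1.
  apply Rle_trans with (Rabs t * (Rabs (/ t) * norm (scal (of_real k t) v))).
  + apply Rmult_le_compat_l; [apply Rabs_pos | apply Hle].
  + rewrite <- Rmult_assoc, <- Rabs_mult, Rinv_r, Rabs_R1 by exact Ht; lra.
Qed.

Lemma norm_gt0 {K : AbsRing} {X : NormedModule K} (v : X) :
  v <> zero -> 0 < norm v.
Proof.
intros Hv; destruct (Rle_lt_or_eq_dec _ _ (norm_ge_0 v)) as [H|H]; [exact H|].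
exfalso; apply Hv, norm_eq_zero; auto.
Qed.

Definition norming {k} {X : NormedModule (scalar_field k)} (x : X)
    (f : X -> AbsRing_NormedModule (scalar_field k)) : Prop :=
  is_linear f /\ (forall v, norm (f v) <= norm v) /\ f x = of_real k (norm x).

(** Normalising [v] turns a dual norm equal to 1 into the bound [norm (f v) <= norm v]. Conversely,
    the supremum 1 is attained at [x] divided by its norm, whence the hypothesis on [x]. *)
Lemma support_functional_iff {k} {X : NormedModule (scalar_field k)} (x : X) f :
  x <> zero -> support_functional x f <-> norming x f.
Proof.
intros Hx; assert (Hx0 := norm_gt0 x Hx).
assert (Hscal : forall v : X, is_linear f -> forall t, 0 <= t ->
  norm (f (scal (of_real k t) v)) = t * norm (f v)).
{ intros v Hf t Ht; rewrite (linear_scal f Hf).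
  rewrite (norm_scal_of_real (X := AbsRing_NormedModule (scalar_field k))).
  rewrite Rabs_pos_eq by exact Ht; reflexivity. }
split.
- intros [Hf [Hd Hfx]]; split; [exact Hf | split; [|exact Hfx]].
  intros v; destruct (Req_dec (norm v) 0) as [H0|H0].
  (* A vector of norm 0 cannot be normalised; boundedness of [f] settles this case. *)
  + destruct (linear_norm f Hf) as [M [_ HM]]; specialize (HM v).
    rewrite H0 in HM |- *; lra.
  + assert (Hv : 0 < norm v) by (assert (H := norm_ge_0 v); lra).
    assert (Hi := Rinv_0_lt_compat _ Hv).
    destruct (Lub_Rbar_correct (fun r : R =>
      exists v : X, norm v <= 1 /\ r = norm (f v))) as [Hub _].
    unfold dual_norm in Hd; rewrite Hd in Hub.
    assert (H1 : norm (f (scal (of_real k (/ norm v)) v)) <= 1).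
    { apply Hub; exists (scal (of_real k (/ norm v)) v); split; [|reflexivity].
      rewrite norm_scal_of_real, Rabs_pos_eq by lra; right; field; lra. }
    rewrite Hscal in H1 by (assumption || lra).
    apply Rmult_le_reg_l with (1 := Hi); rewrite Rinv_l; assumption.
- intros [Hf [Hle Hfx]]; split; [exact Hf | split; [|exact Hfx]].
  apply is_lub_Rbar_unique; split.
  + intros r [v [Hv ->]]; apply Rle_trans with (1 := Hle v); exact Hv.
  + intros b Hb; apply Hb; exists (scal (of_real k (/ norm x)) x); split.
    * rewrite norm_scal_of_real, Rabs_pos_eq
        by (left; apply Rinv_0_lt_compat, Hx0); right; field; lra.
    * rewrite Hscal, Hfx by (assumption || (left; apply Rinv_0_lt_compat, Hx0)).
      change (1 = / norm x * abs (of_real k (norm x))).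
      rewrite abs_of_real, Rabs_pos_eq by lra; field; lra.
Qed.

Lemma smooth_iff {k} {X : NormedModule (scalar_field k)} (x : X) :
  x <> zero -> smooth x <-> exists! f, norming x f.
Proof.
intros Hx; unfold smooth; split.
- intros [_ [f [Hf Hu]]]; exists f; split.
  + apply support_functional_iff; assumption.
  + intros g Hg; apply Hu, support_functional_iff; assumption.
- intros [f [Hf Hu]]; split; [exact Hx|]; exists f; split.
  + apply support_functional_iff; assumption.
  + intros g Hg; apply Hu, support_functional_iff; assumption.
Qed.

(* The zero functional is norming at [zero], so that in a sum a norming
   functional can be chosen at every coordinate; this is why the condition
   [dual_norm f = 1] is relaxed in [norming]. *)
Lemma norming_zero {k} {X : NormedModule (scalar_field k)} :
  norming (zero : X) (fun _ => zero).
Proof.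
split; [apply is_linear_zero | split].
- intros v; rewrite norm_zero; apply norm_ge_0.
- rewrite norm_zero, of_real_0; reflexivity.
Qed.

(** * Hoelder's inequality *)

(** With q the conjugate exponent, the q-norm of r^(p-1) is the (p-1)-th power of the p-norm of r,
    so q can be left out of the statement. The inequality comes from summing the tangent
    inequalities at [r n], evaluated at a suitable multiple of [b n]. *)
Lemma holder (p : R) (r b : nat -> R) :
  1 < p -> (forall n, 0 <= r n) -> (forall n, 0 <= b n) ->
  ex_series (fun n => rpow (r n) p) -> ex_series (fun n => rpow (b n) p) ->
  ex_series (fun n => rpow (r n) (p - 1) * b n) /\
  Series (fun n => rpow (r n) (p - 1) * b n) <=
    rpow (rpow (Series (fun n => rpow (r n) p)) (/ p)) (p - 1) *
    rpow (Series (fun n => rpow (b n) p)) (/ p).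
Proof.
intros Hp Hr Hb Hsr Hsb.
assert (Hrp : forall n, rpow (r n) p = rpow (r n) (p - 1) * r n)
  by (intros n; apply rpow_pred, Hr).
(* The dominating series is Young's inequality, that is, the tangent inequality at [r n] evaluated
   at [b n] and divided by [p]. *)
assert (Hex : ex_series (fun n => rpow (r n) (p - 1) * b n)).
{ apply ex_series_le_pos with
    (fun n => / p * rpow (b n) p + (1 - / p) * rpow (r n) p).
  - intros n; split; [apply Rmult_le_pos; [apply rpow_ge0 | apply Hb]|].
    assert (Ht := rpow_tangent p (r n) (b n) Hp (Hr n)).
    apply Rmult_le_reg_l with p; [lra|].
    replace (p * (/ p * rpow (b n) p + (1 - / p) * rpow (r n) p))
      with (rpow (b n) p + (p - 1) * rpow (r n) p) by (field; lra).
    rewrite Hrp in *; lra.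
  - apply (ex_series_plus (V := R_NormedModule));
    apply (ex_series_scal_l (V := R_NormedModule)); assumption. }
split; [exact Hex|].
set (sr := Series (fun n => rpow (r n) p)).
set (sb := Series (fun n => rpow (b n) p)).
assert (Hsr0 : 0 <= sr)
  by (apply Series_ge0; [intros; apply rpow_ge0 | exact Hsr]).
assert (Hsb0 : 0 <= sb)
  by (apply Series_ge0; [intros; apply rpow_ge0 | exact Hsb]).
assert (Hzero : forall a : nat -> R, (forall n, 0 <= a n) ->
  ex_series (fun n => rpow (a n) p) -> Series (fun n => rpow (a n) p) = 0 ->
  forall n, a n = 0).
{ intros a Ha Hsa E n.
  assert (H := Series_ge_term (fun n => rpow (a n) p) n
    (fun n => rpow_ge0 _ _) Hsa); simpl in H; rewrite E in H.
  destruct (Rle_lt_or_eq_dec _ _ (Ha n)) as [Hn|Hn]; [|auto].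
  assert (H' := rpow_gt0 (a n) p Hn); lra. }
assert (Hrhs : 0 <= rpow (rpow sr (/ p)) (p - 1) * rpow sb (/ p))
  by (apply Rmult_le_pos; apply rpow_ge0).
destruct (Rle_lt_or_eq_dec _ _ Hsr0) as [Hsr1|Hsr1]; cycle 1.
(* Writing the zero term as a product lets [Series_scal_l] evaluate the series. *)
{ rewrite (Series_ext _ (fun n => 0 * 0)).
  - rewrite Series_scal_l; lra.
  - intros n; rewrite (Hzero r) by auto; rewrite rpow_0; ring. }
destruct (Rle_lt_or_eq_dec _ _ Hsb0) as [Hsb1|Hsb1]; cycle 1.
{ rewrite (Series_ext _ (fun n => 0 * 0)).
  - rewrite Series_scal_l; lra.
  - intros n; rewrite (Hzero b) by auto; ring. }
set (N := rpow sr (/ p)); set (M := rpow sb (/ p)).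
assert (HN : 0 < N) by (apply rpow_gt0, Hsr1).
assert (HM : 0 < M) by (apply rpow_gt0, Hsb1).
assert (HNp : rpow N p = sr) by (apply rpow_inv_l; lra).
assert (HMp : rpow M p = sb) by (apply rpow_inv_l; lra).
(* This factor gives [t * b] the same p-norm as [r], so that both sides of the summed tangent
   inequality can be expressed through [sr]. *)
set (t := N / M).
assert (Ht : 0 < t) by (apply Rdiv_lt_0_compat; assumption).
set (S1 := Series (fun n => rpow (r n) (p - 1) * b n)).
assert (Hsum : p * t * S1 + sr <= rpow t p * sb + p * sr).
{ unfold sr, S1, sb; rewrite <- !Series_scal_l, <- !Series_plus;
    try (apply (ex_series_scal_l (V := R_NormedModule))); try assumption.
  apply Series_le.
  - intros n; split.
    + apply Rplus_le_le_0_compat; [|apply rpow_ge0].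
      apply Rmult_le_pos; [apply Rmult_le_pos; lra|].
      apply Rmult_le_pos; [apply rpow_ge0 | apply Hb].
    + assert (H := rpow_tangent p (r n) (t * b n) Hp (Hr n)).
      rewrite rpow_mult in H by (apply Hb || lra).
      rewrite !Hrp in *; lra.
  - apply (ex_series_plus (V := R_NormedModule));
    apply (ex_series_scal_l (V := R_NormedModule)); assumption. }
assert (Htp : rpow t p * sb = sr).
{ rewrite <- HMp, <- rpow_mult by lra; rewrite <- HNp; f_equal.
  unfold t; field; lra. }
rewrite Htp in Hsum.
assert (H1 : t * S1 <= sr) by nra.
rewrite <- HNp, rpow_pred in H1 by lra.
apply Rmult_le_reg_l with (1 := Ht).
apply Rle_trans with (1 := H1); unfold t; right; field; lra.
Qed.

(** * Coordinate embeddings and tails *)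

(** It serves both for vectors supported at one coordinate and for exchanging one functional in a
    family. As the types depend on the index, [u] has to be transported along [n = m]. *)
Definition update {T : nat -> Type} (f : forall m, T m) (n : nat) (u : T n) :
    forall m, T m :=
  fun m => match Nat.eq_dec n m with
           | left e => eq_rect n T u m e
           | right _ => f m
           end.

Lemma update_same {T : nat -> Type} (f : forall m, T m) n (u : T n) :
  update f n u n = u.
Proof.
unfold update; destruct (Nat.eq_dec n n) as [e|]; [|congruence].
rewrite (UIP_dec Nat.eq_dec e eq_refl); reflexivity.
Qed.

Lemma update_other {T : nat -> Type} (f : forall m, T m) n (u : T n) m :
  m <> n -> update f n u m = f m.
Proof.
intros H; unfold update; destruct (Nat.eq_dec n m); [congruence | reflexivity].
Qed.

Lemma minus_plus_plus {G : AbelianGroup} (a b c d : G) :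
  minus (plus a b) (plus c d) = plus (minus a c) (minus b d).
Proof.
unfold minus; rewrite opp_plus, <- !plus_assoc; f_equal.
rewrite !plus_assoc; f_equal; apply plus_comm.
Qed.

Section SmoothSum.
Variables (k : scalars) (X : nat -> NormedModule (scalar_field k)).
Variables (p : R) (Hp : 1 < p).
Notation L := (lp_sum X (Rlt_le 1 p Hp)).
Notation dual V := (V -> AbsRing_NormedModule (scalar_field k)).

Lemma lp_sum_ext (v w : L) :
  (forall n, lp_coord v n = lp_coord w n) -> v = w.
Proof. apply lp_seq_ext. Qed.

Lemma lp_coord_plus (v w : L) n :
  lp_coord (plus v w) n = plus (lp_coord v n) (lp_coord w n).
Proof. reflexivity. Qed.

Lemma lp_coord_scal l (v : L) n :
  lp_coord (scal l v : L) n = scal l (lp_coord v n).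
Proof. reflexivity. Qed.

Lemma lp_sum_norm (v : L) :
  norm v = rpow (Series (fun n => rpow (norm (lp_coord v n)) p)) (/ p).
Proof. reflexivity. Qed.

Lemma lp_sum_norm_pow (v : L) :
  rpow (norm v) p = Series (fun n => rpow (norm (lp_coord v n)) p).
Proof.
rewrite lp_sum_norm; apply rpow_inv_l; [|lra].
apply Series_ge0; [intros; apply rpow_ge0 | exact (lp_summable v)].
Qed.

Lemma single_is_series n (u : X n) :
  is_series (fun m => rpow (norm (update (fun m => zero : X m) n u m)) p)
    (rpow (norm u) p).
Proof.
replace (rpow (norm u) p)
  with (rpow (norm (update (fun m => zero : X m) n u n)) p)
  by (rewrite update_same; reflexivity).
apply (is_series_single n
  (fun m => rpow (norm (update (fun m => zero : X m) n u m)) p)).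
intros m Hm; rewrite update_other, norm_zero by exact Hm; apply rpow_0.
Qed.

Definition single n (u : X n) : L :=
  mk_lp_seq (update (fun m => zero : X m) n u)
    (ex_intro _ _ (single_is_series n u)).

Lemma single_same n (u : X n) : lp_coord (single n u) n = u.
Proof. apply (update_same (T := X)). Qed.

Lemma single_other n (u : X n) m : m <> n -> lp_coord (single n u) m = zero.
Proof. apply (update_other (T := X)). Qed.

Lemma norm_single n (u : X n) : norm (single n u) = norm u.
Proof.
rewrite lp_sum_norm.
rewrite (is_series_unique (fun m => rpow (norm (lp_coord (single n u) m)) p)
  _ (single_is_series n u)).
apply rpow_inv_r; [apply norm_ge_0 | lra].
Qed.

Lemma single_plus n (u v : X n) :
  single n (plus u v) = plus (single n u) (single n v).
Proof.
apply lp_sum_ext; intros m; rewrite lp_coord_plus.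
destruct (Nat.eq_dec m n) as [->|Hm].
- rewrite !single_same; reflexivity.
- rewrite !single_other, plus_zero_r by exact Hm; reflexivity.
Qed.

Lemma single_scal n l (u : X n) : single n (scal l u) = scal l (single n u).
Proof.
apply lp_sum_ext; intros m; rewrite lp_coord_scal.
destruct (Nat.eq_dec m n) as [->|Hm].
- rewrite !single_same; reflexivity.
- rewrite !single_other by exact Hm.
  symmetry; apply (scal_zero_r (V := X m)).
Qed.

(** The two series of [p]-th powers differ in the [n]-th term only, so their difference is a
    one-term series. *)
Lemma lp_norm_plus_single (x : L) n (u : X n) :
  rpow (norm (plus x (single n u))) p =
  rpow (norm x) p - rpow (norm (lp_coord x n)) p +
  rpow (norm (plus (lp_coord x n) u)) p.
Proof.
rewrite !lp_sum_norm_pow.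
set (a := fun m => rpow (norm (lp_coord x m)) p).
set (b := fun m => rpow (norm (lp_coord (plus x (single n u)) m)) p).
assert (H : is_series (fun m => b m - a m) (b n - a n)).
{ apply (is_series_single n (fun m => b m - a m)); intros m Hm; unfold a, b.
  rewrite lp_coord_plus, single_other, plus_zero_r by exact Hm; ring. }
apply is_series_unique in H; rewrite Series_minus in H.
- unfold b at 2 in H; unfold a at 2 in H.
  rewrite lp_coord_plus, single_same in H; lra.
- exact (lp_summable (plus x (single n u))).
- exact (lp_summable x).
Qed.

Lemma tail_summable (v : L) (M : nat) :
  ex_series (fun m =>
    rpow (norm (if lt_dec m M then zero else lp_coord v m)) p).
Proof.
apply ex_series_le_pos with (2 := lp_summable v); intros m.
split; [apply rpow_ge0|]; destruct (lt_dec m M); [|apply Rle_refl].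
rewrite norm_zero, rpow_0; apply rpow_ge0.
Qed.

(** Splitting off one coordinate at a time from the tail replaces finite sums of [single] vectors in
    the density argument. *)
Definition tail (v : L) (M : nat) : L :=
  mk_lp_seq (fun m => if lt_dec m M then zero else lp_coord v m)
    (tail_summable v M).

Lemma tail_lt (v : L) M m : (m < M)%nat -> lp_coord (tail v M) m = zero.
Proof. intros H; simpl; destruct (lt_dec m M); [reflexivity | lia]. Qed.

Lemma tail_ge (v : L) M m :
  (M <= m)%nat -> lp_coord (tail v M) m = lp_coord v m.
Proof. intros H; simpl; destruct (lt_dec m M); [lia | reflexivity]. Qed.

Lemma tail_0 (v : L) : tail v 0 = v.
Proof. apply lp_sum_ext; intros m; apply tail_ge; lia. Qed.

Lemma tail_S (v : L) M :
  tail v M = plus (single M (lp_coord v M)) (tail v (S M)).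
Proof.
apply lp_sum_ext; intros m; rewrite lp_coord_plus.
destruct (lt_eq_lt_dec m M) as [[Hm| ->]|Hm].
- rewrite !tail_lt, single_other, plus_zero_r by lia; reflexivity.
- rewrite tail_ge, tail_lt, single_same, plus_zero_r by lia; reflexivity.
- rewrite !tail_ge, single_other, plus_zero_l by lia; reflexivity.
Qed.

Lemma norm_tail_small (v : L) (eps : R) :
  0 < eps -> exists M, norm (tail v M) <= eps.
Proof.
intros Heps; set (a := fun m => rpow (norm (lp_coord v m)) p).
assert (Ha : ex_series a) by exact (lp_summable v).
assert (Hlim : is_lim_seq (sum_n a) (Series a)) by exact (Series_correct a Ha).
apply is_lim_seq_spec in Hlim.
destruct (Hlim (mkposreal _ (rpow_gt0 eps p Heps))) as [M HM].
specialize (HM M (Nat.le_refl M)); simpl in HM.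
(* [sum_n a M] includes the index [M], so the remainder starts at [S M]. *)
exists (S M).
assert (E : Series a = sum_n a M +
  Series (fun m => rpow (norm (lp_coord (tail v (S M)) m)) p)).
{ rewrite (Series_incr_n a (S M)) by (lia || exact Ha).
  rewrite sum_n_Reals; simpl pred; f_equal.
  symmetry; rewrite (Series_incr_n_aux _ (S M)).
  - apply Series_ext; intros m; rewrite tail_ge by lia; reflexivity.
  - intros m Hm; rewrite tail_lt, norm_zero by exact Hm; apply rpow_0. }
rewrite <- (lp_sum_norm_pow (tail v (S M))) in E; apply Rabs_def2 in HM.
rewrite <- (rpow_inv_r (norm (tail v (S M))) p) by (apply norm_ge_0 || lra).
rewrite <- (rpow_inv_r eps p) by lra.
apply rpow_le.
- left; apply Rinv_0_lt_compat; lra.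
- split; [apply rpow_ge0 | lra].
Qed.

(** * Functionals determined by their restrictions to the summands *)

(** Removing coordinates does not change the value of [h], so [h v] equals [h] at every tail of [v];
    the tails tend to 0 in norm and [h] is bounded. *)
Lemma linear_eq_zero (h : dual L) :
  is_linear h -> (forall n (u : X n), h (single n u) = zero) ->
  forall v, h v = zero.
Proof.
intros Hh H v.
assert (Ht : forall M, h v = h (tail v M)).
{ induction M as [|M IH]; [rewrite tail_0; reflexivity|].
  rewrite IH, tail_S, (linear_plus h Hh), H; apply plus_zero_l. }
destruct (linear_norm h Hh) as [C [HC Hb]].
apply norm_eq_zero, Rle_antisym; [|apply norm_ge_0].
apply le_epsilon; intros eps Heps.
destruct (norm_tail_small v (eps / C)) as [M HM];
  [apply Rdiv_lt_0_compat; assumption|].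
rewrite (Ht M); apply Rle_trans with (1 := Hb _).
apply Rle_trans with (C * (eps / C)); [|right; field; lra].
apply Rmult_le_compat_l; lra.
Qed.

Lemma linear_single_ext (f g : dual L) :
  is_linear f -> is_linear g ->
  (forall n (u : X n), f (single n u) = g (single n u)) -> f = g.
Proof.
intros Hf Hg H; apply functional_extensionality; intros v.
assert (Hd : is_linear (fun v => minus (f v) (g v))).
{ split.
  - intros v1 v2; rewrite (linear_plus f Hf), (linear_plus g Hg).
    apply (minus_plus_plus (G := AbsRing_NormedModule (scalar_field k))).
  - intros l v1; rewrite (linear_scal f Hf), (linear_scal g Hg).
    symmetry; apply (scal_minus_distr_l l (f v1) (g v1)).
  - destruct (linear_norm f Hf) as [C [HC Hbf]].
    destruct (linear_norm g Hg) as [D [HD Hbg]].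
    exists (C + D); split; [lra|]; intros v1.
    apply Rle_trans with (1 := norm_triangle _ _); rewrite norm_opp.
    specialize (Hbf v1); specialize (Hbg v1); lra. }
apply plus_reg_r with (opp (g v)); rewrite plus_opp_r.
apply (linear_eq_zero _ Hd); intros n u; rewrite H.
apply (minus_eq_zero (G := AbsRing_NormedModule (scalar_field k))).
Qed.

(** * Gluing functionals on the coordinates *)

(** The last hypothesis says that [a] acts boundedly on the norm sequences, a dual-norm bound stated
    as a Hoelder estimate. It makes the defining series converge absolutely and bounds its sum. *)
Lemma dominated_functional (a : nat -> R) (h : forall n, dual (X n)) (C : R) :
  0 < C -> (forall n, is_linear (h n)) ->
  (forall n (u : X n), norm (h n u) <= a n * norm u) ->
  (forall v : L, ex_series (fun n => a n * norm (lp_coord v n)) /\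
     Series (fun n => a n * norm (lp_coord v n)) <= C * norm v) ->
  let f : dual L := fun v => scalar_sum (fun n => h n (lp_coord v n)) in
  is_linear f /\ (forall v, norm (f v) <= C * norm v) /\
  (forall n u, f (single n u) = h n u).
Proof.
intros HC Hh Hle Ha f.
assert (Hex : forall v : L, ex_series (fun n => abs (h n (lp_coord v n)))).
{ intros v; apply ex_series_le_pos with (2 := proj1 (Ha v)); intros n.
  split; [apply abs_ge_0 | apply Hle]. }
assert (Hb : forall v, norm (f v) <= C * norm v).
{ intros v; apply Rle_trans with (2 := proj2 (Ha v)).
  apply Rle_trans with (1 := abs_scalar_sum_le _ (Hex v)).
  apply Series_le; [|exact (proj1 (Ha v))].
  intros n; split; [apply abs_ge_0 | apply Hle]. }
split; [split | split].
- intros v w; unfold f.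
  etransitivity; [|exact (scalar_sum_plus _ _ (Hex v) (Hex w))]; f_equal.
  apply functional_extensionality; intros n.
  rewrite lp_coord_plus; apply (linear_plus _ (Hh n)).
- intros l v; unfold f.
  etransitivity; [|exact (scalar_sum_mult l _ (Hex v))]; f_equal.
  apply functional_extensionality; intros n.
  rewrite lp_coord_scal; apply (linear_scal _ (Hh n)).
- exists C; split; assumption.
- exact Hb.
- intros n u; unfold f; rewrite (scalar_sum_single n).
  + rewrite single_same; reflexivity.
  + intros m Hm; rewrite single_other by exact Hm; apply (linear_zero _ (Hh m)).
Qed.

(** The partial derivative of the p-norm in the [n]-th entry, taken at the sequence of norms of the
    coordinates of [x]. *)
Definition weight (x : L) (n : nat) : R :=
  rpow (norm (lp_coord x n)) (p - 1) / rpow (norm x) (p - 1).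

Lemma weight_ge0 (x : L) n : x <> zero -> 0 <= weight x n.
Proof.
intros Hx; apply Rmult_le_pos; [apply rpow_ge0|].
left; apply Rinv_0_lt_compat, rpow_gt0, norm_gt0, Hx.
Qed.

Lemma weight_gt0 (x : L) n :
  x <> zero -> lp_coord x n <> zero -> 0 < weight x n.
Proof.
intros Hx Hxn; apply Rdiv_lt_0_compat; apply rpow_gt0, norm_gt0; assumption.
Qed.

Lemma weight_eq0 (x : L) n : lp_coord x n = zero -> weight x n = 0.
Proof.
intros H; unfold weight; rewrite H, norm_zero, rpow_0; apply Rmult_0_l.
Qed.

Lemma weight_holder (x v : L) :
  x <> zero ->
  ex_series (fun n => weight x n * norm (lp_coord v n)) /\
  Series (fun n => weight x n * norm (lp_coord v n)) <= norm v.
Proof.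
intros Hx.
assert (HN := rpow_gt0 _ (p - 1) (norm_gt0 x Hx)).
destruct (holder p (fun n => norm (lp_coord x n)) (fun n => norm (lp_coord v n)))
  as [Hex Hle]; try (intros; apply norm_ge_0).
- exact Hp.
- exact (lp_summable x).
- exact (lp_summable v).
- assert (E : forall n, / rpow (norm x) (p - 1) *
    (rpow (norm (lp_coord x n)) (p - 1) * norm (lp_coord v n)) =
    weight x n * norm (lp_coord v n)) by (intros n; unfold weight; field; lra).
  rewrite <- !lp_sum_norm in Hle; split.
  + apply ex_series_ext with (1 := E).
    apply (ex_series_scal_l (V := R_NormedModule)); exact Hex.
  + rewrite <- (Series_ext _ _ E), Series_scal_l.
    apply Rmult_le_reg_l with (1 := HN).
    rewrite <- Rmult_assoc, Rinv_r, Rmult_1_l; lra.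
Qed.

(** Hoelder's inequality bounds the weighted sum by the norm, with equality at [x]. The values on
    [single n u] are recorded so that uniqueness can be carried between the sum and the summands. *)
Lemma norming_sum_exists (x : L) (g : forall n, dual (X n)) :
  x <> zero -> (forall n, norming (lp_coord x n) (g n)) ->
  exists f : dual L, norming x f /\
    forall n u, f (single n u) = scal (of_real k (weight x n)) (g n u).
Proof.
intros Hx Hg.
destruct (dominated_functional (weight x)
  (fun n u => scal (of_real k (weight x n)) (g n u)) 1) as [Hl [Hb Hs]].
- lra.
- intros n; apply (is_linear_comp (g n) (fun y => scal _ y)); [apply Hg|].
  apply is_linear_scal_r; intros; apply scalar_mult_comm.
- intros n u; rewrite (norm_scal_of_real
    (X := AbsRing_NormedModule (scalar_field k))).
  rewrite Rabs_pos_eq by (apply weight_ge0, Hx).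
  apply Rmult_le_compat_l; [apply weight_ge0, Hx | apply Hg].
- intros v; rewrite Rmult_1_l; apply weight_holder, Hx.
- eexists; split; [split; [exact Hl | split] | exact Hs].
  + intros v; specialize (Hb v); rewrite Rmult_1_l in Hb; exact Hb.
  + assert (Hx0 := norm_gt0 x Hx).
    assert (HN := rpow_gt0 _ (p - 1) Hx0).
    (* Equality in Hoelder: the terms are |x_n|^p / |x|^(p-1), and the numerators add up to
       |x|^p. *)
    assert (E : Series (fun n => weight x n * norm (lp_coord x n)) = norm x).
    { rewrite (Series_ext _ (fun n => / rpow (norm x) (p - 1) *
        rpow (norm (lp_coord x n)) p)).
      - rewrite Series_scal_l, <- lp_sum_norm_pow, (rpow_pred (norm x) p) by lra.
        field; lra.
      - intros n; rewrite (rpow_pred (norm (lp_coord x n)) p) by apply norm_ge_0.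
        unfold weight; field; lra. }
    rewrite <- E at 1; rewrite <- scalar_sum_of_real.
    * f_equal; apply functional_extensionality; intros n.
      rewrite (proj2 (proj2 (Hg n))); apply of_real_mult.
    * apply ex_series_ext with (2 := proj1 (weight_holder x x Hx)); intros n.
      symmetry; apply Rabs_pos_eq, Rmult_le_pos;
        [apply weight_ge0, Hx | apply norm_ge_0].
Qed.

(** * Restricting a norming functional to a summand *)

(* The one-sided derivative bound for the norm in the [n]-th coordinate, before
   the passage to the limit: it follows from the tangents of the [p]-th power at
   [|x|] and at [|x_n + u|]. *)
Lemma norming_single_le (x : L) (f : dual L) n (u : X n) :
  x <> zero -> norming x f ->
  rpow (norm x) (p - 1) * scalar_re (f (single n u)) <=
  rpow (norm (plus (lp_coord x n) u)) (p - 1) *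
    (norm (plus (lp_coord x n) u) - norm (lp_coord x n)).
Proof.
intros Hx [Hl [Hb Hfx]].
set (r := norm (lp_coord x n)); set (r' := norm (plus (lp_coord x n) u)).
set (c := scalar_re (f (single n u))).
assert (Hx0 := norm_gt0 x Hx).
(* As [f] norms [x], the left side is the real part of [f] at the perturbed vector. *)
assert (Hc : norm x + c <= norm (plus x (single n u))).
{ apply Rle_trans with (2 := Hb _).
  apply Rle_trans with (2 := scalar_re_le_abs _).
  apply Rle_trans with (2 := Rle_abs _).
  rewrite (linear_plus f Hl), Hfx.
  right; symmetry; etransitivity; [apply scalar_re_plus|].
  rewrite scalar_re_of_real; reflexivity. }
assert (H1 := rpow_tangent p (norm x) (norm (plus x (single n u))) Hp
  (Rlt_le _ _ Hx0)).
rewrite lp_norm_plus_single in H1; fold r r' in H1.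
assert (H2 := rpow_tangent p r' r Hp (norm_ge_0 _)).
assert (H3 := rpow_gt0 _ (p - 1) Hx0).
apply Rmult_le_reg_l with p; [lra|].
apply Rle_trans with (p * rpow (norm x) (p - 1) *
  (norm (plus x (single n u)) - norm x)); [|lra].
rewrite <- Rmult_assoc; apply Rmult_le_compat_l; [nra | lra].
Qed.

(** Apply [norming_single_le] to t u, bound |x_n + t u| by |x_n| + t |u|, divide by t |u| and let t
    tend to 0. *)
Lemma scalar_re_single_le (x : L) (f : dual L) n (u : X n) :
  x <> zero -> norming x f ->
  scalar_re (f (single n u)) <= weight x n * norm u.
Proof.
intros Hx Hf; assert (HN := rpow_gt0 _ (p - 1) (norm_gt0 x Hx)).
set (c := scalar_re (f (single n u))); set (r := norm (lp_coord x n)).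
assert (Hr : 0 <= r) by apply norm_ge_0.
destruct (Req_dec (norm u) 0) as [Hu|Hu].
{ rewrite Hu, Rmult_0_r; apply Rle_trans with (1 := Rle_abs _).
  apply Rle_trans with (1 := scalar_re_le_abs _).
  apply Rle_trans with (1 := proj1 (proj2 Hf) _).
  rewrite norm_single; lra. }
assert (Hu0 : 0 < norm u) by (assert (H := norm_ge_0 u); lra).
assert (Hlim : rpow (norm x) (p - 1) * c / norm u <= rpow r (p - 1)).
{ apply le_rpow_lim with (norm u); [lra | exact Hr |]; intros t Ht.
  assert (H := norming_single_le x f n (scal (of_real k t) u) Hx Hf).
  rewrite single_scal, (linear_scal f (proj1 Hf)) in H.
  change (scal (of_real k t) (f (single n u)))
    with (mult (of_real k t) (f (single n u))) in H.
  rewrite scalar_re_of_real_mult in H; fold c r in H.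
  set (r' := norm (plus (lp_coord x n) (scal (of_real k t) u))) in H.
  assert (Hr' : r' <= r + t * norm u).
  { apply Rle_trans with (1 := norm_triangle _ _).
    rewrite norm_scal_of_real, Rabs_pos_eq by lra; apply Rle_refl. }
  assert (Hr'0 : 0 <= r') by apply norm_ge_0.
  assert (Htu : 0 < t * norm u) by (apply Rmult_lt_0_compat; lra).
  (* Since [r' - r] may be negative, this factor is enlarged first, while the power in front of it
     is still [rpow r' (p - 1)]; monotonicity of the power comes second. *)
  assert (H' : rpow r' (p - 1) * (r' - r) <=
    rpow (r + t * norm u) (p - 1) * (t * norm u)).
  { apply Rle_trans with (rpow r' (p - 1) * (t * norm u)).
    - apply Rmult_le_compat_l; [apply rpow_ge0 | lra].
    - apply Rmult_le_compat_r; [lra | apply rpow_le; lra]. }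
  apply Rmult_le_reg_r with (1 := Htu).
  apply Rle_trans with (2 := H'), Rle_trans with (2 := H).
  right; field; lra. }
unfold weight; fold r.
replace c with (rpow (norm x) (p - 1) * c / norm u *
  (norm u / rpow (norm x) (p - 1))) by (field; lra).
replace (rpow r (p - 1) / rpow (norm x) (p - 1) * norm u)
  with (rpow r (p - 1) * (norm u / rpow (norm x) (p - 1))) by (field; lra).
apply Rmult_le_compat_r; [|exact Hlim].
left; apply Rdiv_lt_0_compat; assumption.
Qed.

(** Here the perturbation is -t x_n, for which |x_n - t x_n| = (1 - t) |x_n| exactly; the negative
    sign turns the derivative bound into a lower bound. *)
Lemma scalar_re_single_coord_ge (x : L) (f : dual L) n :
  x <> zero -> norming x f ->
  weight x n * norm (lp_coord x n) <=
  scalar_re (f (single n (lp_coord x n))).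
Proof.
intros Hx Hf; assert (HN := rpow_gt0 _ (p - 1) (norm_gt0 x Hx)).
set (xn := lp_coord x n); set (c := scalar_re (f (single n xn))).
set (r := norm xn).
destruct (Req_dec r 0) as [Hr|Hr].
{ rewrite Hr, Rmult_0_r; unfold c; rewrite (norm_eq_zero xn Hr).
  assert (E : single n zero = zero).
  { apply norm_eq_zero; rewrite norm_single; apply norm_zero. }
  rewrite E, (linear_zero f (proj1 Hf)); right; symmetry.
  apply scalar_re_zero. }
assert (Hr0 : 0 < r) by (assert (H := norm_ge_0 xn); unfold r in *; lra).
assert (Hlim : rpow r (p - 1) <= rpow (norm x) (p - 1) * c / r).
{ apply rpow_lim_le with (- r); [lra | lra |]; intros t Ht.
  assert (H := norming_single_le x f n (scal (of_real k (- t)) xn) Hx Hf).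
  rewrite single_scal, (linear_scal f (proj1 Hf)) in H.
  change (scal (of_real k (- t)) (f (single n xn)))
    with (mult (of_real k (- t)) (f (single n xn))) in H.
  rewrite scalar_re_of_real_mult in H; fold xn in H; fold c r in H.
  assert (E : norm (plus xn (scal (of_real k (- t)) xn)) = r + t * - r).
  { replace (plus xn (scal (of_real k (- t)) xn))
      with (scal (of_real k (1 - t)) xn).
    - rewrite norm_scal_of_real, Rabs_pos_eq by lra; fold r; ring.
    - unfold Rminus; rewrite of_real_plus, of_real_1.
      etransitivity; [apply (scal_distr_r (V := X n))|]; f_equal.
      apply (scal_one (V := X n)). }
  rewrite E in H.
  apply Rmult_le_reg_r with (t * r); [apply Rmult_lt_0_compat; lra|].
  replace (rpow (norm x) (p - 1) * c / r * (t * r))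
    with (- (rpow (norm x) (p - 1) * (- t * c))) by (field; lra).
  lra. }
unfold weight; fold xn r.
replace c with (rpow (norm x) (p - 1) * c / r *
  (r / rpow (norm x) (p - 1))) by (field; lra).
replace (rpow r (p - 1) / rpow (norm x) (p - 1) * r)
  with (rpow r (p - 1) * (r / rpow (norm x) (p - 1))) by (field; lra).
apply Rmult_le_compat_r; [|exact Hlim].
left; apply Rdiv_lt_0_compat; assumption.
Qed.

(** If x_n is non-zero, [g] is the restriction of [f] divided by the weight: the upper bound gives
    norm at most 1 and the lower bound gives the value at x_n. If x_n = 0, the weight is 0, so [f]
    vanishes on the summand and the zero functional will do. *)
Lemma norming_component (x : L) (f : dual L) n :
  x <> zero -> norming x f ->
  exists g, norming (lp_coord x n) g /\
    forall u, f (single n u) = scal (of_real k (weight x n)) (g u).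
Proof.
intros Hx Hf.
(* The bound on real parts passes to the modulus by absorbing the rotation [l] into [u]. *)
assert (Hle : forall u, norm (f (single n u)) <= weight x n * norm u).
{ intros u; apply abs_le_of_re; intros l Hl.
  change (mult l (f (single n u))) with (scal l (f (single n u))).
  rewrite <- (linear_scal f (proj1 Hf)), <- single_scal.
  apply Rle_trans with (1 := scalar_re_single_le x f n _ Hx Hf).
  apply Rmult_le_compat_l; [apply weight_ge0, Hx|].
  apply Rle_trans with (1 := norm_scal _ _).
  assert (H := norm_ge_0 u); nra. }
destruct (classic (lp_coord x n = zero)) as [Hxn|Hxn].
- exists (fun _ => zero); split; [rewrite Hxn; apply norming_zero|].
  intros u; transitivity (zero : AbsRing_NormedModule (scalar_field k)).
  + apply norm_eq_zero, Rle_antisym; [|apply norm_ge_0].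
    specialize (Hle u); rewrite (weight_eq0 x n Hxn) in Hle; lra.
  + symmetry.
    apply (scal_zero_r (V := AbsRing_NormedModule (scalar_field k))).
- assert (Hw := weight_gt0 x n Hx Hxn).
  assert (Hi := Rinv_0_lt_compat _ Hw).
  exists (fun u => scal (of_real k (/ weight x n)) (f (single n u))).
  assert (Hb : forall u,
    norm (scal (of_real k (/ weight x n)) (f (single n u))) <= norm u).
  { intros u; rewrite (norm_scal_of_real
      (X := AbsRing_NormedModule (scalar_field k))), Rabs_pos_eq by lra.
    apply Rmult_le_reg_l with (1 := Hw).
    rewrite <- Rmult_assoc, Rinv_r, Rmult_1_l by lra; apply Hle. }
  split; [split; [split | split]|].
  + intros u v; rewrite single_plus, (linear_plus f (proj1 Hf)).
    apply (scal_distr_l (V := AbsRing_NormedModule (scalar_field k))).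
  + intros l u; rewrite single_scal, (linear_scal f (proj1 Hf)).
    etransitivity;
      [apply (scal_assoc (V := AbsRing_NormedModule (scalar_field k)))|].
    rewrite scalar_mult_comm; symmetry.
    apply (scal_assoc (V := AbsRing_NormedModule (scalar_field k))).
  + exists 1; split; [lra|]; intros u; rewrite Rmult_1_l; apply Hb.
  + exact Hb.
  + apply of_real_of_re; [apply Hb|].
    change (scal (of_real k (/ weight x n)) (f (single n (lp_coord x n))))
      with (mult (of_real k (/ weight x n)) (f (single n (lp_coord x n)))).
    rewrite scalar_re_of_real_mult; apply Rmult_le_reg_l with (1 := Hw).
    rewrite <- Rmult_assoc, Rinv_r, Rmult_1_l by lra.
    apply scalar_re_single_coord_ge; assumption.
  + intros u; symmetry; etransitivity;
      [apply (scal_assoc (V := AbsRing_NormedModule (scalar_field k)))|].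
    rewrite of_real_mult, Rinv_r, of_real_1 by lra.
    apply (scal_one (V := AbsRing_NormedModule (scalar_field k))).
Qed.

Lemma norming_components (x : L) (f : dual L) :
  x <> zero -> norming x f ->
  exists g : forall n, dual (X n), forall n, norming (lp_coord x n) (g n) /\
    forall u, f (single n u) = scal (of_real k (weight x n)) (g n u).
Proof.
intros Hx Hf.
exists (fun n => proj1_sig (constructive_indefinite_description _
  (norming_component x f n Hx Hf))).
intros n; apply (proj2_sig (constructive_indefinite_description _
  (norming_component x f n Hx Hf))).
Qed.

(** * Transfer of smoothness *)

Lemma scal_weight_inj (x : L) n (y z : AbsRing_NormedModule (scalar_field k)) :
  x <> zero -> lp_coord x n <> zero ->
  scal (of_real k (weight x n)) y = scal (of_real k (weight x n)) z -> y = z.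
Proof.
intros Hx Hxn H; assert (Hw := weight_gt0 x n Hx Hxn).
assert (E : forall w : AbsRing_NormedModule (scalar_field k),
  scal (of_real k (/ weight x n)) (scal (of_real k (weight x n)) w) = w).
{ intros w; etransitivity;
    [apply (scal_assoc (V := AbsRing_NormedModule (scalar_field k)))|].
  rewrite of_real_mult, Rinv_l, of_real_1 by lra.
  apply (scal_one (V := AbsRing_NormedModule (scalar_field k))). }
rewrite <- (E y), H; apply E.
Qed.

(** Exchange the [n]-th component of the norming functional of [x] for a rival [h] and glue again.
    Uniqueness at [x] makes the two glued functionals equal, and the non-zero weight cancels. *)
Lemma smooth_sum_coord (x : L) n :
  x <> zero -> smooth x -> lp_coord x n <> zero -> smooth (lp_coord x n).
Proof.
intros Hx Hs Hxn; apply smooth_iff; [exact Hxn|].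
apply smooth_iff in Hs; [|exact Hx]; destruct Hs as [f [Hf Huniq]].
destruct (norming_components x f Hx Hf) as [g Hg].
exists (g n); split; [apply Hg|]; intros h Hh.
destruct (norming_sum_exists x (update (T := fun m => dual (X m)) g n h) Hx)
  as [f' [Hf' Hs']].
- intros m; destruct (Nat.eq_dec m n) as [->|Hm].
  + rewrite update_same; exact Hh.
  + rewrite update_other by exact Hm; apply Hg.
- apply functional_extensionality; intros u.
  apply (scal_weight_inj x n); [exact Hx | exact Hxn |].
  rewrite <- (proj2 (Hg n)), (Huniq f' Hf'), Hs', update_same; reflexivity.
Qed.

(** Two norming functionals of [x] agree on every summand: where x_n = 0 both have weight 0,
    elsewhere their components coincide by smoothness of x_n. Existence comes from gluing chosen
    norming functionals. *)
Lemma smooth_coord_sum (x : L) :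
  x <> zero ->
  (forall n, lp_coord x n <> zero -> smooth (lp_coord x n)) -> smooth x.
Proof.
intros Hx Hs; apply smooth_iff; [exact Hx|].
assert (Hex : forall n, exists g, norming (lp_coord x n) g).
{ intros n; destruct (classic (lp_coord x n = zero)) as [Hxn|Hxn].
  - exists (fun _ => zero); rewrite Hxn; apply norming_zero.
  - destruct (proj1 (smooth_iff _ Hxn) (Hs n Hxn)) as [g [Hg _]].
    exists g; exact Hg. }
destruct (norming_sum_exists x
  (fun n => proj1_sig (constructive_indefinite_description _ (Hex n))) Hx)
  as [f [Hf _]].
{ intros n; apply (proj2_sig (constructive_indefinite_description _ (Hex n))). }
exists f; split; [exact Hf|]; intros f' Hf'.
apply linear_single_ext; [apply Hf | apply Hf' |]; intros n u.
destruct (norming_component x f n Hx Hf) as [g [Hg Eg]].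
destruct (norming_component x f' n Hx Hf') as [g' [Hg' Eg']].
rewrite Eg, Eg'; destruct (classic (lp_coord x n = zero)) as [Hxn|Hxn].
- rewrite (weight_eq0 x n Hxn), of_real_0.
  transitivity (zero : AbsRing_NormedModule (scalar_field k)); [|symmetry];
  apply (scal_zero_l (V := AbsRing_NormedModule (scalar_field k))).
- destruct (proj1 (smooth_iff _ Hxn) (Hs n Hxn)) as [h [_ Hh]].
  rewrite <- (Hh g Hg), <- (Hh g' Hg'); reflexivity.
Qed.

End SmoothSum.

Theorem corollary11 (k : scalars)
  (X : nat -> NormedModule (scalar_field k))
  (HX : forall n : nat, exists v : X n, v <> zero)
  (p : R) (Hp : 1 < p)
  (x : lp_sum X (Rlt_le 1 p Hp)) (Hx : x <> zero) :
  smooth x <->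
  (forall n : nat, lp_coord x n <> zero -> smooth (lp_coord x n)).
Proof.
split.
- intros Hs n; apply smooth_sum_coord; assumption.
- apply smooth_coord_sum, Hx.
Qed.
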